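(* There exists a perfect set $P\subseteq\mathbb{R}^\omega$ (nonempty, closed, without isolated points) such that every two distinct elements of $P$ are orthogonal, $\mathrm{supp}(x)=\omega$ for every $x\in P$, and, if we define $$h(n)=\min\{|x(n)|:x\in P\}$$ for $n\in\omega$ (these minima being attained), then for every real number $p$ $$\sum_{n<\omega}h(n)^p=\infty.$$
   Context: $\mathbb{R}^\omega$ is the set of all real sequences indexed by $\omega=\{0,1,2,\dots\}$, with the product topology. For $x,y\in\mathbb{R}^\omega$ the inner product is $(x,y)=\sum_{n\in\omega}x(n)y(n)$, which need not be finite or exist; $x$ and $y$ are orthogonal if the series $(x,y)$ converges (as the limit of its partial sums) and equals $0$. The support of $x\in\mathbb{R}^\omega$ is $\mathrm{supp}(x)=\{n\in\omega:x(n)\neq0\}$. *)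

(* Defs.v *)
From HB Require Import structures.
From mathcomp Require Import all_boot all_order all_algebra.
From mathcomp Require Import all_classical all_reals all_analysis.

Set Implicit Arguments.
Unset Strict Implicit.
Unset Printing Implicit Defensive.

Import Order.TTheory GRing.Theory Num.Theory.
Import numFieldNormedType.Exports.

Local Open Scope classical_set_scope.
Local Open Scope ring_scope.

(* The series may converge only conditionally, so orthogonality is about
   the limit of the partial sums in their natural order. *)
Definition seq_orthogonal (R : realType) (x y : nat -> R) : Prop :=
  series (fun n => x n * y n) @ \oo --> (0 : R).

Definition supp (R : realType) (x : nat -> R) : set nat :=
  [set n | x n != 0].

Definition is_minimum (R : realType) (A : set R) (m : R) : Prop :=
  A m /\ lbound A m.

(* Main.v *)
Require Import Defs.
From HB Require Import structures.
From mathcomp Require Import all_boot all_order all_algebra.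
From mathcomp Require Import all_classical all_reals all_analysis.
From mathcomp Require Import ring lra zify.

(** All points of the perfect set have the same absolute values and differ
    only by signs, so that h is known in advance and orthogonality becomes a
    statement about Walsh characters.

    Identify a point z of Cantor space with a sequence of signs z_i.  Attach
    to each n a level d_n and a finite set l_n of indices, all at most d_n, and
    put x_z(n) = a_n * prod_(i in l_n) z_i with a_n = 2^-d_n.  The map z |-> x_z
    is continuous, and it is injective because x_z is orthogonal to x_y for
    z <> y but not to itself; hence its range is perfect ([perfect_range]).
    Moreover (x_z, x_y) = sum_n a_n^2 * prod_(i in l_n) u_i where u = z y,
    so the sum has to converge to 0 for every sequence of signs u <> 1.

    The sets come in periods.  At level d, a lower period runs through all
    subsets of {0, ..., d-1} and an upper period through the same subsets with
    d added to each.  Such a period contributes a multiple of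
    prod_(i < d) (1 + u_i).  Let k be the first index with u_k = -1.
    - A period of level d > k contributes 0.
    - A period of level d < k contributes its full weight 2^d 4^-d = 2^-d.
    - At level k, lower periods contribute their weight and upper periods its
      opposite.
    So the sum cancels at the end of level k as soon as the upper periods of
    level k weigh as much as the lower ones of that level and everything before
    together.  Since the lower periods contribute positively for d < k, their
    numbers are free, and the numbers of upper periods follow by recursion
    ([carry]).  After level k the partial sums vanish at the end of each period
    and inside a period of level d they are at most 2^-d, hence they tend to 0
    ([corr_cvg0]).

    Taking 2^(d^2) lower periods at level d makes h(n) = a_n take the value 2^-d
    so often that the sum of h(n)^p over level d is at least 2^d once d >= p
    ([block_powR_ge]). *)

Import Order.TTheory GRing.Theory Num.Theory.
Import numFieldNormedType.Exports.

Local Open Scope classical_set_scope.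
Local Open Scope ring_scope.

(** * Perfect sets as images of Cantor space *)

(** Compactness makes the image closed; injectivity is what keeps the points
    near x from collapsing onto f x. *)
Lemma perfect_range {T U : topologicalType} (f : T -> U) :
  compact [set: T] -> perfect_set [set: T] -> hausdorff_space U ->
  continuous f -> injective f -> perfect_set (range f).
Proof.
move=> cT [_ pT] hU cf injf.
have clf : closed (range f).
  apply: compact_closed => //; apply: continuous_compact => //.
  exact: continuous_subspaceT.
split=> //; apply/seteqP; split=> [y limy|_ [x _ <-] V /cf fV].
  apply/clf => V /limy[_ [_ [x _ <-] Vfx]].
  by exists (f x); split=> //; exists x.
have : limit_point [set: T] x by rewrite pT.
move=> /(_ _ fV)[x' [xx' _ Vfx']]; exists (f x'); split=> //.
by apply: contra_neq xx' => /injf.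
Qed.

Lemma continuous_ptws {T : topologicalType} {I : eqType} {U : topologicalType}
    (f : T -> {ptws I -> U}) :
  (forall i, continuous (fun x => f x i)) -> continuous f.
Proof.
move=> cf x; apply/cvg_sup => i V [W] [[A oA <-] Afx] AV.
apply: filterS AV _.
by apply: (cf i x); apply: open_nbhs_nbhs; split.
Qed.

(** * Infinite concatenations *)

Section Concat.
Context {T : Type} (x0 : T) (B : nat -> seq T).
Hypothesis B_neq0 : forall d, (0 < size (B d))%N.

Definition concat (M : nat) : seq T := flatten [seq B d | d <- iota 0 M].

(** The block number n ends after position n, since no block is empty. *)
Definition concat_nth (n : nat) : T := nth x0 (concat n.+1) n.

Lemma concatS M : concat M.+1 = concat M ++ B M.
Proof. by rewrite /concat -addn1 iotaD map_cat flatten_cat /= cats0. Qed.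

Lemma concat_le M N : (M <= N)%N -> exists s, concat N = concat M ++ s.
Proof.
move=> /subnK <-; elim: (N - M)%N => [|k [s IH]]; first by exists [::]; rewrite cats0.
by rewrite addSn concatS IH -catA; eexists.
Qed.

Lemma size_concat M : (M <= size (concat M))%N.
Proof.
elim: M => // M IH; rewrite concatS size_cat -addn1; exact: leq_add.
Qed.

Lemma nth_concat M n : (n < size (concat M))%N ->
  nth x0 (concat M) n = concat_nth n.
Proof.
move=> nM; rewrite /concat_nth.
have nn := size_concat n.+1.
have [/concat_le[s ->]|/ltnW/concat_le[s ->]] := leqP M n.+1.
  by rewrite nth_cat nM.
by rewrite nth_cat nn.
Qed.

Lemma take_concat M N : (N <= size (concat M))%N ->
  take N (concat M) = mkseq concat_nth N.
Proof.
move=> NM; apply: (@eq_from_nth _ x0); first by rewrite size_takel// size_mkseq.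
move=> i; rewrite size_takel// => iN.
by rewrite nth_take// nth_mkseq// nth_concat// (leq_trans iN).
Qed.

(** Turns partial sums of series into sums over lists, where whole blocks can
    be split off. *)
Lemma sum_concat_nth {V : nmodType} (g : T -> V) M N :
  (N <= size (concat M))%N ->
  \sum_(0 <= i < N) g (concat_nth i) = \sum_(x <- take N (concat M)) g x.
Proof. by move=> NM; rewrite take_concat// big_map /index_iota subn0. Qed.

End Concat.

(** The complete lists inside a prefix cancel, so only the part of the list
    that is cut counts. *)
Lemma prefix_sum_bound {T : Type} {R : numDomainType} (g : T -> R) (c : R)
    (ss : seq (seq T)) :
  0 <= c ->
  all (fun s => (\sum_(x <- s) g x == 0) && (\sum_(x <- s) `|g x| <= c)) ss ->
  forall N, `|\sum_(x <- take N (flatten ss)) g x| <= c.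
Proof.
move=> c0; elim: ss => [|s ss IH] /=; first by move=> _ N; rewrite big_nil normr0.
move=> /andP[/andP[/eqP s0 sc] /IH {}IH] N; rewrite take_cat.
case: ltnP => _; last by rewrite big_cat /= s0 add0r.
apply: le_trans (ler_norm_sum _ _ _) (le_trans _ sc).
by rewrite -{2}(cat_take_drop N s) big_cat /= lerDl sumr_ge0.
Qed.

Lemma sumr_const_seq {T : Type} {V : nmodType} (s : seq T) (c : V) :
  \sum_(x <- s) c = c *+ size s.
Proof. by rewrite big_const_seq count_predT iter_addr_0. Qed.

(** * The frequencies *)

(** The subsets of {0, ..., d-1}, written as lists of indices. *)
Fixpoint cube (d : nat) : seq (seq nat) :=
  if d is e.+1 then cube e ++ [seq e :: l | l <- cube e] else [:: [::]].

Definition period (d : nat) (b : bool) : seq (nat * seq nat) :=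
  [seq (d, if b then d :: l else l) | l <- cube d].

(** The number of lower periods at level d; it outgrows every 2^(p d). *)
Definition filler (d : nat) : nat := (2 ^ (d * d))%N.

(** The weight of all levels before d, measured in periods of level d: passing
    to the next level halves the weight of a period, whence
    carry (d+1) = 2 (carry d + filler d + (filler d + carry d)). *)
Fixpoint carry (d : nat) : nat :=
  if d is e.+1 then (4 * (carry e + filler e))%N else 0%N.

Definition periods (d : nat) : seq (seq (nat * seq nat)) :=
  nseq (filler d) (period d false) ++ nseq (filler d + carry d) (period d true).

Definition block (d : nat) : seq (nat * seq nat) := flatten (periods d).

Definition frequency : nat -> nat * seq nat := concat_nth (0%N, [::]) block.

Lemma size_cube d : size (cube d) = (2 ^ d)%N.
Proof. by elim: d => //= d IH; rewrite size_cat size_map IH expnS; lia. Qed.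

Lemma size_block d : size (block d) = ((filler d + (filler d + carry d)) * 2 ^ d)%N.
Proof.
rewrite /block size_flatten /shape /periods map_cat !map_nseq sumn_cat !sumn_nseq.
by rewrite !size_map size_cube; lia.
Qed.

Lemma filler_gt0 d : (0 < filler d)%N. Proof. by rewrite expn_gt0. Qed.

Lemma block_neq0 d : (0 < size (block d))%N.
Proof. by rewrite size_block muln_gt0 expn_gt0 addn_gt0 filler_gt0. Qed.

Lemma mem_periods d s : s \in periods d -> exists b, s = period d b.
Proof.
by rewrite mem_cat !mem_nseq => /orP[]/andP[_ /eqP ->]; eexists.
Qed.

Lemma block_level d x : x \in block d -> x.1 = d.
Proof.
by move=> /flattenP[s /mem_periods[b ->]] /mapP[l _ ->].
Qed.

Lemma concat_periods d m :
  concat block (d + m) =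
  concat block d ++ flatten (flatten [seq periods e | e <- iota d m]).
Proof.
rewrite /concat iotaD map_cat flatten_cat add0n; congr (_ ++ _).
by elim: (iota d m) => //= e s ->; rewrite flatten_cat.
Qed.

(** * Correlations *)

Section Correlation.
Context {R : realType}.

Definition walsh (u : nat -> R) (l : seq nat) : R := \prod_(i <- l) u i.

Definition amplitude (d : nat) : R := 2^-1 ^+ d.

(** For u = z y this is the product of the entries of x_z and x_y at a
    position of frequency x. *)
Definition corr (u : nat -> R) (x : nat * seq nat) : R :=
  amplitude x.1 ^+ 2 * walsh u x.2.

(** Expanding the product gives one Walsh character for each subset. *)
Lemma sum_cube u d : \sum_(l <- cube d) walsh u l = \prod_(i < d) (1 + u i).
Proof.
elim: d => [|d IH]; first by rewrite /= big_seq1 big_ord0 /walsh big_nil.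
rewrite big_ord_recr /= big_cat big_map /= -IH mulrDr mulr1; congr (_ + _).
by rewrite mulrC big_distrr /=; apply: eq_bigr => l _; rewrite /walsh big_cons.
Qed.

Lemma sum_period u d b : \sum_(x <- period d b) corr u x =
  amplitude d ^+ 2 * (if b then u d else 1) * \prod_(i < d) (1 + u i).
Proof.
rewrite big_map -sum_cube big_distrr; apply: eq_bigr => l _.
by rewrite /corr; case: b; rewrite ?mulr1// /walsh big_cons mulrA.
Qed.

Lemma sum_block u d : \sum_(x <- block d) corr u x =
  (filler d)%:R * (\sum_(x <- period d false) corr u x) +
  (filler d + carry d)%:R * (\sum_(x <- period d true) corr u x).
Proof.
rewrite /block big_flatten big_cat /=; congr (_ + _).
  by rewrite big_nseq iter_addr_0 mulr_natl.
by rewrite big_nseq iter_addr_0 mulr_natl.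
Qed.

Section Separated.
Variables (u : nat -> R) (k : nat).
Hypotheses (u_lt : forall i, (i < k)%N -> u i = 1) (u_k : u k = -1).
Hypothesis u_norm : forall i, `|u i| <= 1.

Lemma prod_lt d : (d <= k)%N -> \prod_(i < d) (1 + u i) = 2 ^+ d.
Proof.
move=> dk; rewrite -[d in RHS]card_ord -prodr_const; apply: eq_bigr => i _.
rewrite (u_lt _ (leq_trans (ltn_ord i) dk)); ring.
Qed.

Lemma prod_gt d : (k < d)%N -> \prod_(i < d) (1 + u i) = 0.
Proof.
by move=> kd; rewrite (bigD1 (Ordinal kd))//= u_k subrr mul0r.
Qed.

(** A period of level d has 2^d terms, so this is its weight; the amplitudes
    are chosen so that it tends to 0. *)
Lemma sqr_amplitudeM d : amplitude d ^+ 2 * 2 ^+ d = amplitude d.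
Proof.
by rewrite /amplitude expr2 -mulrA -exprMn mulVf// expr1n mulr1.
Qed.

Lemma sum_block_lt d : (d < k)%N ->
  \sum_(x <- block d) corr u x = (2 * filler d + carry d)%:R * amplitude d.
Proof.
move=> dk; rewrite sum_block !sum_period prod_lt 1?ltnW// u_lt// mulr1.
by rewrite sqr_amplitudeM -mulrDl -natrD; congr (_%:R * _); lia.
Qed.

(** The lower periods cancel against as many upper ones; the surplus of upper
    periods remains. *)
Lemma sum_block_eq : \sum_(x <- block k) corr u x = - (carry k)%:R * amplitude k.
Proof.
rewrite sum_block !sum_period prod_lt// u_k mulrN1 mulr1 !mulNr.
by rewrite sqr_amplitudeM natrD; ring.
Qed.

Lemma sum_concat_le d : (d <= k)%N ->
  \sum_(x <- concat block d) corr u x = (carry d)%:R * amplitude d.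
Proof.
elim: d => [_|d IH dk]; first by rewrite big_nil mul0r.
rewrite concatS big_cat /= IH 1?ltnW// sum_block_lt//.
rewrite /amplitude exprS -mulrDl -natrD mulrA; congr (_ * _).
by apply: (mulIf (x := 2)) => //; rewrite mulfVK// -natrM; congr (_%:R); lia.
Qed.

(** This balance is what the recursion for [carry] is made for. *)
Lemma sum_concat_eq : \sum_(x <- concat block k.+1) corr u x = 0.
Proof.
by rewrite concatS big_cat /= sum_concat_le// sum_block_eq mulNr subrr.
Qed.

Lemma walsh_norm l : `|walsh u l| <= 1.
Proof.
rewrite /walsh; elim: l => [|i l IH]; first by rewrite big_nil normr1.
by rewrite big_cons normrM mulr_ile1.
Qed.

Lemma amplitude_gt0 d : 0 < amplitude d.
Proof. by rewrite exprn_gt0// invr_gt0. Qed.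

Lemma amplitude_le d e : (d <= e)%N -> amplitude e <= amplitude d.
Proof. by move=> de; apply: ler_wiXn2l => //; lra. Qed.

(** Bounds the partial sums inside a period by its weight, without any use of
    signs. *)
Lemma period_norm d b : \sum_(x <- period d b) `|corr u x| <= amplitude d.
Proof.
rewrite big_map -sqr_amplitudeM -natrX -size_cube mulr_natr.
rewrite -sumr_const_seq; apply: ler_sum => l _.
by rewrite normrM ger0_norm ?sqr_ge0// ler_piMr ?sqr_ge0// walsh_norm.
Qed.

Lemma sum_period_gt d b : (k < d)%N -> \sum_(x <- period d b) corr u x = 0.
Proof. by move=> kd; rewrite sum_period prod_gt// mulr0. Qed.

Lemma sum_concat_gt d : (k < d)%N -> \sum_(x <- concat block d) corr u x = 0.
Proof.
elim: d => // d IH; rewrite ltnS leq_eqVlt => /predU1P[<-|kd].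
  exact: sum_concat_eq.
by rewrite concatS big_cat /= IH// sum_block !sum_period_gt// !mulr0 !add0r.
Qed.

(** After level k every period sums to 0, so a partial sum is a partial sum
    inside a single period. *)
Lemma prefix_concat_bound d m N : (k < d)%N ->
  (size (concat block d) <= N)%N ->
  `|\sum_(x <- take N (concat block (d + m))) corr u x| <= amplitude d.
Proof.
move=> kd dN; rewrite concat_periods take_cat ltnNge dN /=.
rewrite big_cat /= sum_concat_gt// add0r.
apply: prefix_sum_bound; first exact/ltW/amplitude_gt0.
apply/allP => s /flatten_mapP[e]; rewrite mem_iota => /andP[de _] /mem_periods[b ->].
rewrite sum_period_gt ?(leq_trans kd)// eqxx/=.
exact: le_trans (period_norm _ _) (amplitude_le _ _ de).
Qed.

Lemma corr_cvg0 :
  series (fun n => corr u (frequency n)) @ \oo --> (0 : R).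
Proof.
apply/cvgrPdist_le => e e0.
have /cvgrPdist_le/(_ _ e0)[d _ dP] : amplitude n @[n --> \oo] --> (0 : R).
  by apply: cvg_expr; rewrite ger0_norm; lra.
have {dP} : amplitude (maxn d k.+1) <= e.
  have := dP _ (leq_maxl d k.+1).
  by rewrite sub0r normrN gtr0_norm ?amplitude_gt0.
set D := maxn d k.+1 => De; exists (size (concat block D)) => // N /= DN.
have DleN : (D <= N)%N := leq_trans (size_concat _ block_neq0 _) DN.
rewrite sub0r normrN seriesEnat /=.
rewrite (sum_concat_nth _ _ block_neq0 _ N) ?size_concat//; last exact: block_neq0.
have := prefix_concat_bound D (N - D) N (leq_maxr _ _) DN.
by rewrite subnKC// => /le_trans; apply.
Qed.

End Separated.

End Correlation.

(** * The perfect set *)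

Section Points.
Context {R : realType}.

Definition sign (z : nat -> bool) (i : nat) : R := (-1) ^+ z i.

Definition point (z : cantor_space) : {ptws nat -> R} :=
  fun n => amplitude (frequency n).1 * walsh (sign z) (frequency n).2.

Lemma norm_walsh_sign z l : `|walsh (sign z) l| = 1.
Proof.
rewrite /walsh; elim: l => [|i l IH]; first by rewrite big_nil normr1.
by rewrite big_cons normrM IH /sign normr_sign mulr1.
Qed.

Lemma norm_point z n : `|point z n| = amplitude (frequency n).1.
Proof.
by rewrite /point normrM norm_walsh_sign mulr1 gtr0_norm// amplitude_gt0.
Qed.

Lemma point_neq0 z n : point z n != 0.
Proof. by rewrite -normr_gt0 norm_point amplitude_gt0. Qed.

Lemma pointM z y n :
  point z n * point y n = corr (fun i => sign z i * sign y i) (frequency n).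
Proof.
by rewrite /corr /walsh big_split /point mulrACA expr2.
Qed.

(** The first index k where z and y differ is the first one where the product
    of their signs is -1. *)
Lemma point_orthogonal z y : z <> y -> seq_orthogonal (point z) (point y).
Proof.
move=> zy; have /ex_minnP[k zyk kmin] : exists i, z i != y i.
  apply: contrapT => /forallNP zyE; apply: zy; apply: funext => i.
  by have /negP := zyE i; rewrite negbK => /eqP.
rewrite /seq_orthogonal; under eq_fun do rewrite pointM.
apply: (corr_cvg0 _ k).
- move=> i ik; rewrite /sign; have [->|/kmin] := eqVneq (z i) (y i).
    by rewrite -signr_addb addbb.
  by rewrite leqNgt ik.
- by rewrite /sign -signr_addb; case: (z k) (y k) zyk => [] [].
- by move=> i; rewrite normrM !normr_sign mulr1.
Qed.

(** The partial sums of squares stay above the first square. *)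
Lemma self_not_orthogonal (x : nat -> R) : x 0%N != 0 -> ~ seq_orthogonal x x.
Proof.
move=> x0 xx; have : x 0%N ^+ 2 <= 0.
  rewrite -(cvg_lim (@Rhausdorff R) xx).
  apply: limr_ge; first by apply/cvg_ex; exists 0.
  exists 1%N => // -[//|n] _ /=.
  rewrite seriesEnat /= big_nat_recl// expr2 lerDl.
  by apply: sumr_ge0 => i _; rewrite -expr2 sqr_ge0.
by rewrite leNgt lt0r sqr_ge0 sqrf_eq0 x0.
Qed.

Lemma point_inj : injective point.
Proof.
move=> z y zyE; apply: contrapT => /point_orthogonal.
by rewrite zyE; apply: self_not_orthogonal; exact: point_neq0.
Qed.

Lemma sign_continuous i : continuous (fun z : cantor_space => sign z i).
Proof.
have cs : continuous (fun b : bool => (-1) ^+ b : R).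
  move=> b; apply: cvg_near_cst.
  by apply: (filterS _ (discrete_set1 b)) => _ ->.
move=> z; apply: (continuous_comp _ (cs (z i))).
exact: (@proj_continuous _ (fun=> bool)).
Qed.

Lemma point_continuous : continuous point.
Proof.
apply: continuous_ptws => n; rewrite /point /walsh.
case: (frequency n) => d l /= z; apply: cvgM; first exact: cvg_cst.
elim: l => [|i l IH].
  by under eq_fun do rewrite big_nil; rewrite big_nil; exact: cvg_cst.
under eq_fun do rewrite big_cons; rewrite big_cons; apply: cvgM => //.
exact: sign_continuous.
Qed.

(** As the amplitude is at most 1, the exponent may be replaced by d; then the
    2^(d^2) lower periods of length 2^d outweigh the value 2^(-d^2). *)
Lemma block_powR_ge (p : R) d : p <= d%:R ->
  2 ^+ d <= \sum_(x <- block d) amplitude x.1 `^ p.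
Proof.
move=> pd; rewrite big_seq (eq_bigr (fun=> amplitude d `^ p)); last first.
  by move=> x /block_level ->.
rewrite -big_seq sumr_const_seq size_block -[leRHS]mulr_natl.
have ad : amplitude d ^+ d <= amplitude d `^ p.
  rewrite -powR_mulrn; last exact/ltW/amplitude_gt0.
  by apply: ger_powR => //; rewrite amplitude_gt0 exprn_ile1//; lra.
have -> : 2 ^+ d = (2 ^ (d * d) * 2 ^ d)%:R * amplitude d ^+ d :> R.
  rewrite /amplitude -exprM natrM !natrX mulrAC -exprMn divff//.
  by rewrite expr1n mul1r.
apply: ler_pM => //; first by rewrite exprn_ge0// ltW// amplitude_gt0.
by rewrite ler_nat leq_mul2r leq_addr orbT.
Qed.

Lemma amplitude_series (p : R) :
  (\sum_(0 <= n <oo) ((amplitude (frequency n).1) `^ p)%:E)%E = +oo%E.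
Proof.
apply: eq_infty => r.
pose d := maxn (Num.truncn p).+1 (Num.truncn r).+1.
have pd : p <= d%:R.
  by apply: le_trans (ltW (truncnS_gt p)) _; rewrite ler_nat leq_maxl.
have rd : r <= 2 ^+ d.
  apply: le_trans (ltW (truncnS_gt r)) _; rewrite -natrX ler_nat.
  exact: leq_trans (leq_maxr _ _) (ltnW (ltn_expl _ _)).
apply: le_trans (nneseries_lim_ge (size (concat block d.+1)) _); last first.
  by move=> n _ _; rewrite lee_fin powR_ge0.
rewrite sumEFin lee_fin.
rewrite (sum_concat_nth _ _ block_neq0 (fun x => amplitude x.1 `^ p) d.+1)//.
rewrite take_size concatS big_cat /=.
apply: le_trans rd (le_trans (block_powR_ge _ _ pd) _).
by rewrite lerDr; apply: sumr_ge0 => *; exact: powR_ge0.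
Qed.

End Points.

Theorem theorem6 (R : realType) :
  exists P : set {ptws nat -> R},
    [/\ P !=set0,
        perfect_set P,
        forall x y : {ptws nat -> R}, P x -> P y -> x <> y ->
          seq_orthogonal x y,
        forall x : {ptws nat -> R}, P x -> supp x = [set: nat] &
        exists h : nat -> R,
          (forall n : nat, is_minimum [set `|x n| | x in P] (h n)) /\
          (forall p : R, (\sum_(0 <= n <oo) ((h n) `^ p)%:E)%E = +oo%E)].
Proof.
exists (range point); split.
- by exists (point (fun=> false)), (fun=> false).
- apply: perfect_range.
  + exact: cantor_space_compact.
  + exact: cantor_perfect.
  + by apply: hausdorff_product => _; exact: Rhausdorff.
  + exact: point_continuous.
  + exact: point_inj.
- move=> _ _ [z _ <-] [y _ <-] zy; apply: point_orthogonal.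
  by apply: contra_not zy => ->.
- by move=> _ [z _ <-]; apply/seteqP; split=> // n _; exact: point_neq0.
- exists (fun n => amplitude (frequency n).1); split; last exact: amplitude_series.
  move=> n; split; last by move=> _ [_ [z _ <-] <-]; rewrite norm_point.
  by exists (point (fun=> false)); [exists (fun=> false)|rewrite norm_point].
Qed.
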